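(* Let $r\in\mathbb{N}$ and let $\mathcal{E}\subset\mathbb{S}^{d-1}$ be a set of directions. (i) If $\operatorname{span}(\mathcal{E})\ne\mathbb{R}^d$, then $\dim\Pi^d_{r-1}(\mathcal{E})=\infty$. (ii) If $\operatorname{span}(\mathcal{E})=\mathbb{R}^d$, i.e. $\mathcal{E}$ contains some $d$ linearly independent directions, then $\Pi^d_{r-1}(\mathcal{E})$ is a finite dimensional space of algebraic polynomials depending on $\mathcal{E}$. Moreover, $\dim\Pi^d_{r-1}(\mathcal{E})\le r^d$ and $\Pi^d_{r-1}(\mathcal{E})\subset\Pi^d_{d(r-1)}$, i.e. the monomials in any element of $\Pi^d_{r-1}(\mathcal{E})$ always have total degree not exceeding $d(r-1)$.
   Context: $\mathbb{S}^{d-1}$ is the unit sphere of $\mathbb{R}^d$ and $\mathbb{N}=\{1,2,\dots\}$. $\Pi^d_n$ is the space of all real algebraic polynomials in $d$ variables of total degree at most $n$. For $\mathcal{E}\subset\mathbb{S}^{d-1}$, $\Pi^d_{r-1}(\mathcal{E})$ is the (linear) set of all real continuous functions $Q$ on $\mathbb{R}^d$ such that for each fixed $x\in\mathbb{R}^d$ and $\xi\in\mathcal{E}$ the function $g(t):=Q(x+t\xi)$ is an algebraic polynomial of degree $<r$ in the variable $t\in\mathbb{R}$. *)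

(* Defs.v *)
From HB Require Import structures.
From mathcomp Require Import all_boot all_order all_algebra.

Set Implicit Arguments.
Unset Strict Implicit.
Unset Printing Implicit Defensive.

(* mpoly's notations clash with those of the analysis library, hence its import
   is confined to a module closed before the latter is loaded. *)
Module MPolyDegree.
From mathcomp Require Import mpoly.

(* [msize p] is the total degree of [p] plus one, and [msize 0 = 0]. *)
Definition total_degree_le (d : nat) (R : nzRingType) (n : nat)
  (p : {mpoly R[d]}) : bool := (msize p <= n.+1)%N.

End MPolyDegree.
Import MPolyDegree.

From mathcomp Require Import all_classical all_reals all_analysis.

Import Order.TTheory GRing.Theory Num.Theory.
Import numFieldNormedType.Exports.

Local Open Scope classical_set_scope.
Local Open Scope ring_scope.

Section LinearAlgebra.
Context {R : fieldType} {V : lmodType R}.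
Implicit Types (A : set V) (n : nat).

Definition lin_subspace A : Prop :=
  A 0 /\ forall (a : R) (u v : V), A u -> A v -> A (a *: u + v).

Definition lin_span A : set V :=
  [set v | exists (n : nat) (a : 'I_n -> R) (e : 'I_n -> V),
     (forall i, A (e i)) /\ v = \sum_(i < n) a i *: e i].

Definition lin_indep n (e : 'I_n -> V) : Prop :=
  forall a : 'I_n -> R, \sum_(i < n) a i *: e i = 0 -> forall i, a i = 0.

Definition lin_basis n (e : 'I_n -> V) A : Prop :=
  lin_indep e /\ lin_span (range e) = A.

Definition has_dim A n : Prop := exists e : 'I_n -> V, lin_basis e A.

Definition finite_dim A : Prop := exists n, has_dim A n.

Definition infinite_dim A : Prop := ~ finite_dim A.

End LinearAlgebra.

Section Spaces.
Context {R : realType}.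

(* The Euclidean sphere; the library's norm on 'rV[R]_d is the sup norm. *)
Definition unit_sphere (d : nat) : set 'rV[R]_d :=
  [set x | \sum_(i < d) x ord0 i ^+ 2 = 1].

(* Elements are polynomial functions, so that they compare with [Pi_dir] below;
   the codomain is [R^o] to get the pointwise [lmodType] structure on functions. *)
Definition Pi_poly (d n : nat) : set ('rV[R]_d -> R^o) :=
  [set Q | exists2 p : mpoly.mpoly d R,
     total_degree_le n p & Q = fun x : 'rV[R]_d => mpoly.meval (x ord0) p].

(* The paper's $\Pi^d_{r-1}(\mathcal{E})$, indexed here by [r]; for
   univariate polynomials [size p <= r] means degree less than [r]. *)
Definition Pi_dir (d r : nat) (E : set 'rV[R]_d) : set ('rV[R]_d -> R^o) :=
  [set Q | continuous Q /\
     forall (x xi : 'rV[R]_d), E xi ->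
       exists2 p : {poly R}, (size p <= r)%N &
         forall t : R, Q (x + t *: xi) = p.[t]].

Lemma Pi_dir_subspace (d r : nat) (E : set 'rV[R]_d) :
  lin_subspace (Pi_dir r E).
Proof.
split.
  split; first by move=> x; exact: cst_continuous.
  by move=> x xi _; exists 0; rewrite ?size_poly0 // => t; rewrite horner0.
move=> a u v [cu hu] [cv hv]; split.
  move=> x; apply: (@continuousD R R^o); last exact: cv.
  by apply: (@continuousM R _ (fun=> a)); [exact: cst_continuous|exact: cu].
move=> x xi Exi; have [p sp hp] := hu x xi Exi; have [q sq hq] := hv x xi Exi.
exists (a *: p + q) => [|t].
  rewrite (leq_trans (size_polyD _ _)) // geq_max sq andbT.
  exact: leq_trans (size_scale_leq _ _) sp.
by rewrite hornerD hornerZ -hp -hq.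
Qed.

End Spaces.

Arguments unit_sphere R d _ : clear implicits.
Arguments Pi_poly R d n _ : clear implicits.

(* Main.v *)
(* (i) If the directions do not span, some nonzero linear form l vanishes on
   them, and the powers l^k are linearly independent and constant along every
   direction.
   (ii) Choose a basis of directions. In the corresponding coordinates Q is,
   separately in each variable, a polynomial of degree < r, and such a function
   is determined by its values on the grid {0, ..., r-1}^d. Hence Q equals its
   tensor Lagrange interpolant there, that is, a combination of r^d fixed
   products of d univariate polynomials of degree r-1. *)
Require Import Defs.
From mathcomp Require Import all_boot all_order all_algebra.

Set Implicit Arguments.
Unset Strict Implicit.
Unset Printing Implicit Defensive.

Import Order.TTheory GRing.Theory Num.Theory.
Import MPolyDegree.

(** * Total degree of multivariate polynomials *)

Module MPolyDegreeTheory.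
From mathcomp Require Import mpoly.
Local Open Scope ring_scope.

Section TotalDegree.
Context {d : nat} {R : idomainType}.
Implicit Types p q : {mpoly R[d]}.

Lemma total_degree_le_linear n (a : R) p q :
  total_degree_le n p -> total_degree_le n q -> total_degree_le n (a *: p + q).
Proof.
move=> hp hq; rewrite /total_degree_le (leq_trans (msizeD_le _ _)) // geq_max.
by rewrite (leq_trans (msizeZ_le _ _)).
Qed.

Lemma total_degree_le0 n : total_degree_le n (0 : {mpoly R[d]}).
Proof. by rewrite /total_degree_le msize0. Qed.

Lemma total_degree_leC n (c : R) : total_degree_le n (c%:MP : {mpoly R[d]}).
Proof. by rewrite /total_degree_le mmeasureC; case: (c != 0). Qed.

Lemma total_degree_leD n p q :
  total_degree_le n p -> total_degree_le n q -> total_degree_le n (p + q).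
Proof. by move=> hp hq; rewrite -[p]scale1r total_degree_le_linear. Qed.

Lemma total_degree_leM m n p q :
  total_degree_le m p -> total_degree_le n q -> total_degree_le (m + n) (p * q).
Proof.
move=> hp hq.
have [->|p0] := eqVneq p 0; first by rewrite mul0r total_degree_le0.
have [->|q0] := eqVneq q 0; first by rewrite mulr0 total_degree_le0.
rewrite /total_degree_le msizeM //.
by have := leq_add hp hq; rewrite addSn addnS; case: (msize p + msize q)%N.
Qed.

Lemma total_degree_le_prod n (I : finType) (F : I -> {mpoly R[d]}) :
  (forall i, total_degree_le n (F i)) ->
  total_degree_le (#|I| * n) (\prod_i F i).
Proof.
move=> hF; rewrite cardE /index_enum -enumT; elim: (enum I) => [|i s IHs].
  by rewrite big_nil -mpolyC1 total_degree_leC.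
by rewrite big_cons /= mulSn total_degree_leM.
Qed.

(** Each step of Horner's scheme multiplies by [p], raising the degree by at most one, and adds a
    constant. *)
Lemma total_degree_le_horner n (q : {poly R}) p :
  total_degree_le 1 p -> (size q <= n.+1)%N ->
  total_degree_le n (map_poly (mpolyC d (R:=R)) q).[p].
Proof.
move=> hp; elim/poly_ind: q n => [|q c IHq] n.
  by rewrite rmorph0 horner0 total_degree_le0.
rewrite size_MXaddC; case: ifP => [/andP[/eqP-> _] _|_].
  by rewrite mul0r add0r map_polyC hornerC total_degree_leC.
rewrite rmorphD rmorphM /= map_polyX map_polyC hornerD hornerM hornerX hornerC.
(* For [n = 0] the size bound leaves only the constant term, so the recursive part is zero. *)
case: n => [|n] sq.
  move: sq; rewrite ltnS size_poly_leq0 => /eqP->.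
  by rewrite rmorph0 horner0 mul0r add0r total_degree_leC.
by rewrite -addn1 total_degree_leD ?total_degree_leC // total_degree_leM // IHq.
Qed.

(** Coordinate [i] of [x *m C] is a linear form [l i]; substituting it into [q i] gives degree at
    most [r.-1], and there are [d] factors. *)
Lemma mpoly_prod_horner_linear r (C : 'M[R]_d) (q : 'I_d -> {poly R}) :
  (forall i, size (q i) <= r)%N ->
  exists2 p : {mpoly R[d]}, total_degree_le (d * r.-1) p &
    forall x : 'rV[R]_d, meval (x ord0) p = \prod_i (q i).[(x *m C) 0 i].
Proof.
move=> sq; pose l i : {mpoly R[d]} := \sum_j C j i *: 'X_j.
exists (\prod_i (map_poly (mpolyC d (R:=R)) (q i)).[l i]) => [|x].
  rewrite -{2}(card_ord d); apply: total_degree_le_prod => i.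
  apply: total_degree_le_horner; last exact: leq_trans (sq i) (leqSpred r).
  rewrite /l; elim/big_rec: _ => [|j p _ hp]; first exact: total_degree_le0.
  by rewrite total_degree_le_linear // /total_degree_le msizeX mdeg1.
rewrite rmorph_prod; apply: eq_bigr => i _ /=.
(* Evaluation is a ring morphism fixing constants, so it passes through Horner and acts only on the
   argument [l i]. *)
rewrite -horner_map /= -map_poly_comp map_poly_id => [|c _ /=]; last first.
  exact: mevalC.
congr (_.[_]); rewrite /l raddf_sum mxE; apply: eq_bigr => j _.
by rewrite /= mevalZ mevalXU mulrC.
Qed.

End TotalDegree.
End MPolyDegreeTheory.
Import MPolyDegreeTheory.

From mathcomp Require Import all_classical all_reals all_analysis.
Import numFieldNormedType.Exports.
(* The notations of mpoly clash with those of the analysis library. *)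
Import (canonicals) mpoly.

Local Open Scope classical_set_scope.
Local Open Scope ring_scope.

(** * Spans, independent families and dimension *)

Section LinearAlgebra.
Context {R : fieldType} {V : lmodType R}.
Implicit Types (A : set V) (n : nat).

Lemma lin_span_rangeP n (e : 'I_n -> V) v :
  lin_span (range e) v <-> exists a : 'I_n -> R, v = \sum_i a i *: e i.
Proof.
split=> [[m [a [g [ge ->]]]]|[a ->]]; last first.
  by exists n, a, e; split=> // i; exists i.
have /choice[s sE] i : exists k, e k = g i by have [k _ <-] := ge i; exists k.
(* A generator may occur several times in the given combination; its coefficients are added up. *)
exists (fun k => \sum_(i | s i == k) a i).
rewrite (partition_big s predT) //=; apply: eq_bigr => k _.
by rewrite scaler_suml; apply: eq_bigr => i /eqP <-; rewrite sE.
Qed.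

Lemma lin_subspace_sum A (I : finType) (a : I -> R) (e : I -> V) :
  lin_subspace A -> (forall i, A (e i)) -> A (\sum_i a i *: e i).
Proof.
move=> [A0 Alin] Ae; elim/big_rec: _ => // i v _ Av; exact: Alin.
Qed.

(** If [n] exceeded the number of generators, the coefficient matrix would have a nonzero left
    kernel vector, which is a nontrivial relation among the [e i]. *)
Lemma lin_indep_leq_card n (e : 'I_n -> V) (I : finType) (g : I -> V) :
  lin_indep e -> (forall i, exists c : I -> R, e i = \sum_k c k *: g k) ->
  (n <= #|I|)%N.
Proof.
move=> indep /choice[c cE]; rewrite leqNgt; apply/negP => ltn.
pose C := \matrix_(i < n, k < #|I|) c i (enum_val k).
have : kermx C != 0.
  by rewrite kermx_eq0 /row_free neq_ltn (leq_ltn_trans (rank_leq_col _)).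
case/rowV0Pn => u /sub_kermxP uC /eqP; apply; apply/rowP => i; rewrite mxE.
apply: (indep (u 0)); under eq_bigr do rewrite cE scaler_sumr.
rewrite exchange_big big1 // => k _.
under eq_bigr do rewrite scalerA.
rewrite -scaler_suml; move/rowP/(_ (enum_rank k)): uC; rewrite !mxE.
by under eq_bigr do rewrite mxE enum_rankK; move=> ->; rewrite scale0r.
Qed.

(** The bound yields an independent family of largest size; a vector of [A] outside its span could
    be prepended, contradicting maximality. *)
Lemma maximal_lin_indep A N :
  (forall n (e : 'I_n -> V), lin_indep e -> (forall i, A (e i)) -> (n <= N)%N) ->
  exists n (e : 'I_n -> V),
    [/\ lin_indep e, forall i, A (e i) & A `<=` lin_span (range e)].
Proof.
move=> bound.
pose P n := `[< exists2 e : 'I_n -> V, lin_indep e & forall i, A (e i) >].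
have P0 : exists n, P n.
  by exists 0%N; apply/asboolP; exists (fun=> 0) => [a _|] [].
have PN n : P n -> (n <= N)%N by move=> /asboolP[e]; exact: bound.
case: (ex_maxnP P0 PN) => n /asboolP[e indep Ae] max.
exists n, e; split=> // v Av; apply/lin_span_rangeP; apply: contrapT => nv.
suff /max : P n.+1 by rewrite ltnn.
apply/asboolP; exists (fun i => oapp e v (unlift ord0 i)) => [a|i]; last first.
  case: unliftP => [j|] _ /=; [exact: Ae|exact: Av].
rewrite big_ord_recl unlift_none /=; under eq_bigr do rewrite liftK /=.
move=> sum0.
(* Otherwise dividing by [a ord0] would express [v] through the [e i]. *)
have a0 : a ord0 = 0.
  apply/eqP; apply/negP => /negP a0; apply: nv.
  exists (fun i => - (a ord0)^-1 * a (lift ord0 i)).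
  under eq_bigr do rewrite -scalerA.
  rewrite -scaler_sumr; move/eqP: sum0; rewrite addr_eq0 => /eqP av.
  by rewrite scaleNr -scalerN -av scalerA mulVf ?scale1r.
move: sum0; rewrite a0 scale0r add0r => /indep a_lift i.
by case: (unliftP ord0 i) => [j|] ->.
Qed.

Lemma subspace_finite_dim A N : lin_subspace A ->
  (forall n (e : 'I_n -> V), lin_indep e -> (forall i, A (e i)) -> (n <= N)%N) ->
  finite_dim A.
Proof.
move=> Asub /maximal_lin_indep[n [e [indep Ae sub]]]; exists n, e; split=> //.
apply/seteqP; split=> // v /lin_span_rangeP[a ->]; exact: lin_subspace_sum.
Qed.

End LinearAlgebra.

(** * Directions as rows of matrices *)

Lemma row_spanning_matrix (F : fieldType) d (E : set 'rV[F]_d) :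
  exists n (M : 'M[F]_(n, d)),
    (forall i, E (row i M)) /\ forall x, E x -> (x <= M)%MS.
Proof.
have [n e indep _|n [e [_ Ee sub]]] := @maximal_lin_indep _ 'rV[F]_d E d.
  rewrite -[d]card_ord.
  apply: (@lin_indep_leq_card _ _ _ e 'I_d (delta_mx 0)) => // i.
  by exists (e i 0); exact: row_sum_delta.
exists n, (\matrix_i e i); split=> [i|x /sub /lin_span_rangeP[a ->]].
  by rewrite rowK.
by apply: summx_sub => i _; rewrite scalemx_sub // -[e i](rowK e) row_sub.
Qed.

(** A spanning matrix [M] not of full rank has a nonzero cokernel; any nonzero column of it kills
    the row space of [M], hence [E]. *)
Lemma span_neqT_annihilator (F : fieldType) d (E : set 'rV[F]_d) :
  lin_span E <> setT ->
  exists2 c : 'cV[F]_d, c != 0 & forall x, E x -> x *m c = 0.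
Proof.
have [n [M [EM sub]]] := row_spanning_matrix E => spanE.
have : cokermx M != 0.
  rewrite cokermx_eq0; apply: contra_notN spanE => fullM.
  apply/seteqP; split=> // x _; have /submxP[D ->] := submx_full x fullM.
  by exists n, (D 0), (fun i => row i M); split=> //; exact: mulmx_sum_row.
case/matrix0Pn => i [j cij].
exists (col j (cokermx M)) => [|x /sub /submxP[D ->]].
  by apply/cV0Pn; exists i; rewrite mxE.
by rewrite colE -mulmxA [M *m _]mulmxA mulmx_coker mul0mx mulmx0.
Qed.

(** A spanning matrix with rows in [E] has full rank, so [d] of its rows form an invertible
    matrix. *)
Lemma span_setT_unitmx (F : fieldType) d (E : set 'rV[F]_d) :
  lin_span E = setT -> exists2 B : 'M[F]_d, B \in unitmx & forall i, E (row i B).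
Proof.
have [n [M [EM sub]]] := row_spanning_matrix E => spanE.
have fullM : row_full M.
  rewrite -sub1mx; apply/row_subP => i.
  have : setT (row i (1%:M : 'M[F]_d)) by [].
  rewrite -spanE => -[m [a [e [Ee ->]]]].
  by apply: summx_sub => k _; rewrite scalemx_sub ?sub.
exists (rowsub (fullrankfun fullM) M) => [|i]; first exact: fullrowsub_unit.
by rewrite row_rowsub.
Qed.

(** * Tensor Lagrange interpolation on an integer grid *)

Section Interpolation.
Context {R : realType}.

Lemma poly_eq0_nat_roots n (p : {poly R}) (c : R) : (size p <= n)%N ->
  (forall k, (k < n)%N -> p.[k%:R + c] = 0) -> p = 0.
Proof.
move=> sp hp; apply/eqP; apply: contraT => p0.
have := @max_poly_roots _ p [seq k%:R + c | k <- iota 0 n] p0.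
rewrite size_map size_iota ltnNge sp; apply.
  by apply/allP => x /mapP[k]; rewrite mem_iota => /andP[_ kn] ->; apply/eqP/hp.
rewrite map_inj_uniq ?iota_uniq // => i j /addIr /eqP.
by rewrite eqr_nat => /eqP.
Qed.

(** For invertible [B] this is polynomiality in each coordinate relative to the basis of rows of
    [B], phrased along lines so as to match [Pi_dir]. *)
Definition separately_poly d r (B : 'M[R]_d) : set ('rV[R]_d -> R^o) :=
  [set f | forall x k, exists2 p : {poly R}, (size p <= r)%N &
    forall t : R, f (x + t *: row k B) = p.[t]].

Lemma separately_poly_subspace d r (B : 'M[R]_d) :
  lin_subspace (separately_poly r B).
Proof.
split=> [x k|a f g hf hg x k].
  by exists 0 => [|t]; rewrite ?size_poly0 ?horner0.
have [p sp pE] := hf x k; have [q sq qE] := hg x k.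
exists (a *: p + q) => [|t]; last by rewrite hornerD hornerZ -pE -qE.
rewrite (leq_trans (size_polyD _ _)) // geq_max sq andbT.
exact: leq_trans (size_scale_leq _ _) sp.
Qed.

Definition grid_point d r (m : {ffun 'I_d -> 'I_r}) : 'rV[R]_d :=
  \row_i (m i)%:R.

(** Along a coordinate line [f] is a polynomial of size at most [r], so vanishing at the [r] grid
    values of that coordinate makes it vanish on the whole line. *)
Lemma separately_poly_eq0 d r (B : 'M[R]_d) f : B \in unitmx ->
  separately_poly r B f ->
  (forall m : {ffun 'I_d -> 'I_r}, f (grid_point m *m B) = 0) ->
  forall x, f x = 0.
Proof.
move=> Bu hf f0 x; rewrite -[x](mulmxKV Bu); move: (x *m _) => {x} t.
(* Coordinates are freed from the grid one at a time. *)
suff H k : (k <= d)%N -> forall t : 'rV[R]_d,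
    (forall i : 'I_d, (k <= i)%N -> exists j : 'I_r, t 0 i = j%:R) ->
    f (t *m B) = 0.
  by apply: (H d) => // i; rewrite leqNgt ltn_ord.
elim: k => [_ {}t tgrid|k IHk kd {}t tgrid].
  have /choice[m mE] : forall i : 'I_d, exists j : 'I_r, t 0 i = j%:R.
    by move=> i; exact: tgrid.
  rewrite (_ : t = grid_point [ffun i => m i]) //.
  by apply/rowP => i; rewrite mxE ffunE mE.
pose kk := Ordinal kd; have [p sp pE] := hf (t *m B) kk.
have p0 : p = 0.
  (* Moving by [j - t 0 kk] along row [kk] of [B] gives coordinate [kk] the grid value [j]. *)
  apply: (@poly_eq0_nat_roots r p (- t 0 kk)) => // j jr.
  rewrite -pE rowE scalemxAl -mulmxDl; apply: IHk => [|i]; first exact: ltnW.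
  rewrite leq_eqVlt => /predU1P[ki|ki]; rewrite !mxE eqxx /=; last first.
    have [j' tE] := tgrid i ki; exists j'.
    by rewrite -val_eqE /= gtn_eqF // mulr0 addr0.
  have -> : i = kk by apply: val_inj.
  by exists (Ordinal jr); rewrite eqxx mulr1 addrC subrK.
by rewrite -[t *m B]addr0 -(scale0r (row kk B)) pE p0 horner0.
Qed.

Definition nat_lagrange r (k : 'I_r) : {poly R} :=
  tnth (qpoly.lagrange r (fun k => k%:R)) k.

(** The tensor Lagrange basis; with [C = invmx B], the row [x *m C] holds the coordinates of [x] in
    the basis of rows of [B]. *)
Definition lagrange_prod d r (C : 'M[R]_d) (m : {ffun 'I_d -> 'I_r}) :
    'rV[R]_d -> R^o :=
  fun x => \prod_i (nat_lagrange (m i)).[(x *m C) 0 i].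

Let natr_inj : injective (fun k : nat => k%:R : R).
Proof. by move=> i j /eqP; rewrite eqr_nat => /eqP. Qed.

Lemma size_nat_lagrange r (k : 'I_r) : size (nat_lagrange k) = r.
Proof.
by apply: qpoly.size_lagrange_ => //; exact: leq_ltn_trans (ltn_ord k).
Qed.

Lemma nat_lagrange_sample r (k j : 'I_r) :
  (nat_lagrange k).[j%:R] = (k == j)%:R.
Proof.
by apply: qpoly.lagrange_sample => //; exact: leq_ltn_trans (ltn_ord k).
Qed.

Variables d r : nat.

Lemma Pi_poly_lagrange_prod C (m : {ffun 'I_d -> 'I_r}) :
  Pi_poly R d (d * r.-1) (lagrange_prod C m).
Proof.
have [|p dp pE] := mpoly_prod_horner_linear (r := r) C
  (q := fun i => nat_lagrange (m i)).
  by move=> i; rewrite size_nat_lagrange.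
by exists p => //; apply/funext => x; rewrite pE.
Qed.

Lemma lagrange_prod_grid_point (B : 'M[R]_d) (m m' : {ffun 'I_d -> 'I_r}) :
  B \in unitmx ->
  lagrange_prod (invmx B) m (grid_point m' *m B) = (m == m')%:R.
Proof.
move=> Bu; rewrite /lagrange_prod mulmxK //.
under eq_bigr do rewrite mxE nat_lagrange_sample.
have [->|/eqP neq] := eqVneq m m'.
  by rewrite big1 // => i _; rewrite eqxx.
have /existsNP[i /eqP/negbTE mi] : ~ forall i, m i = m' i by move/ffunP.
by rewrite (bigD1 i) //= mi mul0r.
Qed.

(** Moving along row [k] of [B] changes only coordinate [k], so every factor but the [k]-th is
    constant. *)
Lemma separately_poly_lagrange_prod (B : 'M[R]_d) (m : {ffun 'I_d -> 'I_r}) :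
  B \in unitmx -> separately_poly r B (lagrange_prod (invmx B) m).
Proof.
move=> Bu x k; set y := x *m invmx B.
pose L i := nat_lagrange (m i).
exists ((\prod_(i | i != k) (L i).[y 0 i]) *: (L k \Po ('X + (y 0 k)%:P))).
  apply: leq_trans (size_scale_leq _ _) _.
  by rewrite size_comp_poly2 ?size_nat_lagrange // size_XaddC.
move=> t; rewrite /lagrange_prod (bigD1 k) //= mulrC hornerZ horner_comp.
have yE i : ((x + t *: row k B) *m invmx B) 0 i = t * (i == k)%:R + y 0 i.
  rewrite mulmxDl -scalemxAl -row_mul mulmxV // !mxE addrC.
  by rewrite [k == i]eq_sym.
rewrite !hornerE yE eqxx mulr1; congr (_ * _).
by apply: eq_bigr => i /negbTE ik; rewrite yE ik mulr0 add0r.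
Qed.

(** The difference of [f] and its interpolant is again separately polynomial and vanishes on the
    grid, hence everywhere. *)
Lemma separately_poly_interpolation (B : 'M[R]_d) (f : 'rV[R]_d -> R^o) :
  B \in unitmx -> separately_poly r B f ->
  f = \sum_(m : {ffun 'I_d -> 'I_r})
        f (grid_point m *m B) *: lagrange_prod (invmx B) m.
Proof.
move=> Bu hf; set g := \sum_m _.
have hg : separately_poly r B g.
  apply: (lin_subspace_sum _ (separately_poly_subspace r B)) => m.
  exact: separately_poly_lagrange_prod.
have gE x : g x = \sum_(m : {ffun 'I_d -> 'I_r})
    f (grid_point m *m B) * lagrange_prod (invmx B) m x by rewrite /g fct_sumE.
have sub : separately_poly r B (- 1 *: g + f).
  exact: (separately_poly_subspace r B).2.
apply/funext => x; have := separately_poly_eq0 Bu sub _ x.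
rewrite scaleN1r => /(_ _)/eqP; rewrite addrC subr_eq0 => H; apply/eqP/H => m.
apply/eqP; rewrite subr_eq0 gE (bigD1 m) //= big1 => [|m' /negbTE m'm].
  by rewrite lagrange_prod_grid_point // eqxx mulr1 addr0.
by rewrite lagrange_prod_grid_point // m'm mulr0.
Qed.

End Interpolation.

(** * Dimension and degree of [Pi_dir] *)

Section Directions.
Context {R : realType}.
Variables d r : nat.
Implicit Types E : set 'rV[R]_d.

Lemma Pi_poly_subspace n : lin_subspace (Pi_poly R d n).
Proof.
split=> [|a _ _ [p dp ->] [q dq ->]].
  by exists 0; [exact: total_degree_le0|apply/funext => x; rewrite mpoly.meval0].
exists (a *: p + q); first exact: total_degree_le_linear.
by apply/funext => x; rewrite mpoly.mevalD mpoly.mevalZ.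
Qed.

Lemma Pi_dir_separately_poly (B : 'M[R]_d) E :
  (forall i, E (row i B)) -> Pi_dir r E `<=` separately_poly r B.
Proof. by move=> EB f [_ hf] x k; exact: hf. Qed.

(** The form [x *m c] does not change along directions of [E], so there its powers are constant
    polynomials, of size at most 1. *)
Lemma Pi_dir_annihilator_exp E (c : 'cV[R]_d) k : (0 < r)%N ->
  (forall x, E x -> x *m c = 0) ->
  Pi_dir r E (fun x => (x *m c) 0 0 ^+ k : R^o).
Proof.
move=> r0 cE; split=> [x|x xi /cE xic].
  apply: (@continuous_comp _ _ _
    (fun x : 'rV[R]_d => (x *m c) 0 0) (fun y : R => y ^+ k)).
    rewrite (_ : (fun _ => _) = (fun x : 'rV[R]_d => \sum_i x 0 i * c i 0)).
      apply: continuous_big => [|i _ y]; first exact: add_continuous.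
      apply: (@continuousM R 'rV[R]_d (fun y => y 0 i)).
        exact: coord_continuous.
      exact: cst_continuous.
    by apply/funext => y; rewrite mxE.
  exact: exprn_continuous.
exists ((x *m c) 0 0 ^+ k)%:P => [|t].
  by rewrite (leq_trans (size_polyC_leq1 _)).
by rewrite hornerC mulmxDl -scalemxAl xic scaler0 addr0.
Qed.

Lemma lin_indep_linear_exp (c : 'cV[R]_d) n : c != 0 ->
  lin_indep (fun (k : 'I_n) (x : 'rV[R]_d) => (x *m c) 0 0 ^+ k : R^o).
Proof.
move=> /cV0Pn[i ci] a sum0.
(* The coefficients [a] are gathered into one univariate polynomial; the default 0 is never read, as
   [k < n]. *)
suff p0 : \poly_(k < n) oapp a 0 (insub k) = 0.
  move=> k; have /(congr1 (fun p : {poly R} => p`_k)) := p0.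
  by rewrite coef_poly ltn_ord valK /= coef0.
apply: (@poly_eq0_nat_roots _ n _ 0) => [|k _]; first exact: size_poly.
(* At this multiple of the [i]-th unit vector the form takes the value [k]. *)
have := congr1 (fun f => f (((k%:R + 0) / c i 0) *: delta_mx 0 i)) sum0.
rewrite /= fct_sumE horner_poly => sum0x; rewrite -[RHS]sum0x.
apply: eq_bigr => j _; rewrite valK /=; congr (_ * _ ^+ _).
by rewrite -scalemxAl -rowE !mxE divfK.
Qed.

(** A basis of [n] elements would span [n.+1] independent powers of the annihilating form. *)
Lemma Pi_dir_infinite_dim E : (0 < r)%N -> lin_span E <> setT ->
  infinite_dim (Pi_dir r E).
Proof.
move=> r0 /span_neqT_annihilator[c c0 cE] [n [e [_ eE]]].
suff : (n.+1 <= #|'I_n|)%N by rewrite card_ord ltnn.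
apply: (lin_indep_leq_card (g := e) (lin_indep_linear_exp (n := n.+1) c0)) => k.
by apply/lin_span_rangeP; rewrite eE; exact: Pi_dir_annihilator_exp.
Qed.

(** By interpolation all the [e i] are combinations of the same [r ^ d] Lagrange products. *)
Lemma Pi_dir_lin_indep_leq E n (e : 'I_n -> 'rV[R]_d -> R^o) :
  lin_span E = setT -> lin_indep e -> (forall i, Pi_dir r E (e i)) ->
  (n <= r ^ d)%N.
Proof.
move=> /span_setT_unitmx[B Bu EB] indep He.
rewrite -[r in (r ^ _)%N]card_ord -[d in (_ ^ d)%N]card_ord -card_ffun.
apply: (lin_indep_leq_card (g := lagrange_prod (invmx B)) indep) => i.
exists (fun m => e i (grid_point m *m B)).
exact: separately_poly_interpolation (Pi_dir_separately_poly EB (He i)).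
Qed.

Lemma Pi_dir_Pi_poly E : lin_span E = setT ->
  Pi_dir r E `<=` Pi_poly R d (d * r.-1).
Proof.
move=> /span_setT_unitmx[B Bu EB] f /(Pi_dir_separately_poly EB) hf.
rewrite (separately_poly_interpolation Bu hf).
apply: (lin_subspace_sum _ (Pi_poly_subspace _)) => m.
exact: Pi_poly_lagrange_prod.
Qed.

End Directions.

Theorem proposition1p2 (R : realType) (d r : nat) (E : set 'rV[R]_d)
    (hd : (0 < d)%N) (hr : (0 < r)%N) (hE : E `<=` unit_sphere R d) :
  (lin_span E <> setT -> infinite_dim (Pi_dir r E)) /\
  (lin_span E = setT ->
     [/\ finite_dim (Pi_dir r E),
         Pi_dir r E `<=` \bigcup_n Pi_poly R d n,
         (forall n, has_dim (Pi_dir r E) n -> (n <= r ^ d)%N) &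
         Pi_dir r E `<=` Pi_poly R d (d * r.-1)%N]).
Proof.
split=> [|spanE]; first exact: Pi_dir_infinite_dim.
split.
- apply: (@subspace_finite_dim _ _ _ (r ^ d)); first exact: Pi_dir_subspace.
  by move=> n e; exact: Pi_dir_lin_indep_leq.
- by move=> f /(Pi_dir_Pi_poly spanE) hf; exists (d * r.-1)%N.
- move=> n [e [indep eE]]; apply: Pi_dir_lin_indep_leq spanE indep _ => i.
  (* Kronecker coefficients show that each basis vector lies in the space it spans. *)
  rewrite -eE; apply/lin_span_rangeP; exists (fun j => (j == i)%:R).
  rewrite (bigD1 i) //= eqxx scale1r big1 ?addr0 // => j /negbTE ->.
  by rewrite scale0r.
- exact: Pi_dir_Pi_poly.
Qed.
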